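(* Let $1<\beta<2$. The following are equivalent: (1) $\beta\in(1,2)\setminus\overline{\mathcal U}$; (2) $\widetilde U_\beta$ is a subshift; (3) $\widetilde U_\beta$ is a subshift of finite type; (4) $\widetilde U_\beta$ is a closed subset of $\{0,1\}^{\mathbb{N}}$; (5) $\widetilde U_\beta$ is a sofic shift. In particular, $\widetilde U_\beta$ is never a strictly sofic shift.
   Context: $\widetilde U_\beta\subseteq\{0,1\}^{\mathbb{N}}$ is the set of sequences $(a_n)$ that are the unique $\beta$-expansion of $\sum a_n\beta^{-n}$ (i.e. no other $(b_n)\in\{0,1\}^{\mathbb{N}}$ has the same value). $\mathcal U$ is the set of $\beta\in(1,2)$ for which $1$ has a unique $\beta$-expansion, and $\overline{\mathcal U}$ its closure. $\{0,1\}^{\mathbb{N}}$ carries the product topology and the left shift $\sigma$. A subshift is a set of all sequences avoiding some collection of forbidden finite words; a subshift of finite type is one for which the collection can be taken finite. A sofic shift is a subshift $Y$ for which there exist a subshift of finite type $\Sigma$ and a continuous surjection $\phi:\Sigma\to Y$ with $\sigma\circ\phi=\phi\circ\sigma$; it is strictly sofic if it is sofic but not of finite type. *)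

(* Defs.v *)
From Stdlib Require Import Reals List.
Import ListNotations.
Open Scope R_scope.

(* Sequences in {0,1}^N are modelled as nat -> bool; index n (0-based)
   corresponds to the paper's digit a_{n+1}, with weight beta^{-(n+1)}. *)
Definition bseq := nat -> bool.

Definition digit (b : bool) : R := if b then 1 else 0.

Definition expansion_value (beta : R) (a : bseq) (x : R) : Prop :=
  infinite_sum (fun n => digit (a n) / beta ^ (S n)) x.

Definition Utilde (beta : R) (a : bseq) : Prop :=
  forall (x : R) (b : bseq),
    expansion_value beta a x -> expansion_value beta b x -> b = a.

Definition in_U (beta : R) : Prop :=
  1 < beta < 2 /\
  exists a : bseq, expansion_value beta a 1 /\
    forall b : bseq, expansion_value beta b 1 -> b = a.

Definition in_closure_U (beta : R) : Prop :=
  forall eps : R, 0 < eps -> exists g : R, in_U g /\ Rabs (g - beta) < eps.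

Definition shift {A : Type} (x : nat -> A) : nat -> A := fun n => x (S n).

Definition agree {A : Type} (n : nat) (x y : nat -> A) : Prop :=
  forall k, (k < n)%nat -> x k = y k.

Definition occurs {A : Type} (w : list A) (x : nat -> A) : Prop :=
  exists i : nat, forall k : nat, (k < length w)%nat ->
    forall d, x (i + k)%nat = nth k w d.

Definition avoids {A : Type} (F : list A -> Prop) (x : nat -> A) : Prop :=
  forall w, F w -> ~ occurs w x.

Definition is_subshift {A : Type} (Y : (nat -> A) -> Prop) : Prop :=
  exists F : list A -> Prop, forall x, Y x <-> avoids F x.

Definition is_SFT {A : Type} (Y : (nat -> A) -> Prop) : Prop :=
  exists F : list (list A), forall x, Y x <-> avoids (fun w => In w F) x.

(* closed in the product topology (discrete alphabet) *)
Definition is_closed {A : Type} (Y : (nat -> A) -> Prop) : Prop :=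
  forall x, (forall n, exists y, Y y /\ agree n x y) -> Y x.

Definition is_sofic (Y : bseq -> Prop) : Prop :=
  is_subshift Y /\
  exists (B : Type) (enumB : list B) (_ : forall b : B, In b enumB)
         (Sigma : (nat -> B) -> Prop) (phi : (nat -> B) -> bseq),
    is_SFT Sigma /\
    (forall x, Sigma x -> Y (phi x)) /\
    (forall y, Y y -> exists x, Sigma x /\ phi x = y) /\
    (* continuity of phi on Sigma (product topologies) *)
    (forall x, Sigma x -> forall n, exists m, forall z, Sigma z ->
        agree m x z -> agree n (phi x) (phi z)) /\
    (forall x, Sigma x -> phi (shift x) = shift (phi x)).

Definition is_strictly_sofic (Y : bseq -> Prop) : Prop :=
  is_sofic Y /\ ~ is_SFT Y.

(* Main.v *)
(** For a digit sequence [a], the tails have values [t_n] in [[0, 1/(g-1)]] with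
    [t_(n+1) = g t_n - a_n], and [a] is a unique expansion in base [g] iff
    [t_(n+1) < 1] after each digit 0 and [t_(n+1) > kappa_g := 1/(g-1) - 1] after
    each digit 1 (the two conditions are exchanged by complementation).

    Let [r_0 = 1, r_1, ...] be the remainders of the quasi-greedy expansion [alpha]
    of 1 in base [beta], so [0 < r_n <= 1].

    If some [r_k <= kappa] with [k >= 1], take the least one; the remainders
    [r_1, ..., r_k] are then [< 1], so in every base near [beta] a unique expansion
    of a number near 1 starts with [alpha_1 ... alpha_k].  In base [beta] this is
    impossible below 1, because the tail after it would be below [kappa]; so the
    tails following a 0 have values bounded away from 1, and uniqueness can be read
    off words of bounded length.  If 1 had a unique expansion [a] in a base [g] near
    [beta], the complement of its k-th tail would have value slightly less than 1,
    hence start like [a], and its own k-th tail would fall below [kappa_g].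

    If all [r_k > kappa], choose [m] such that [(r_m - kappa) / beta^m] is a record
    minimum and let [u = alpha_1 ... alpha_m].  All tails of [e = (u u~)^oo] lie
    strictly between [kappa] and 1.  As [m] grows, the unique expansions [0 e] tend to
    [0 alpha], which is not one, so the set is not closed.  Either [alpha] is itself
    unique and [beta] is in U, or [r_p = 1] for some [p >= 1]; then for large
    [K] with [r_K = 1] the sequence [alpha_1 ... alpha_K e] is the unique expansion
    of 1 in a base slightly smaller than [beta]. *)

Require Import Defs.
From Stdlib Require Import Reals Ranalysis5 List Lra Lia Wf_nat Classical
  FunctionalExtensionality.
From Coquelicot Require Import Coquelicot.
Open Scope R_scope.

(** * Tail values of digit sequences in a base g *)

Definition tailval (g : R) (a : bseq) (n : nat) : R :=
  Series (fun i => digit (a (n + i)%nat) / g ^ S i).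

(** The value of the all-ones sequence, hence the largest possible tail value. *)
Definition cap (g : R) : R := / (g - 1).

Definition compl (a : bseq) : bseq := fun n => negb (a n).

Definition tail (k : nat) (a : bseq) : bseq := fun i => a (k + i)%nat.

Definition splice (n : nat) (a d : bseq) : bseq :=
  fun i => if (i <? n)%nat then a i else d (i - n)%nat.

Definition univoque (g : R) (a : bseq) : Prop :=
  forall n, (a n = false -> tailval g a (S n) < 1) /\
            (a n = true -> cap g - 1 < tailval g a (S n)).

Lemma digit_bounds b : 0 <= digit b <= 1.
Proof. destruct b; simpl; lra. Qed.

Lemma cap_pos g : 1 < g -> 0 < cap g.
Proof. intros; apply Rinv_0_lt_compat; lra. Qed.

Lemma cap_fix g : 1 < g -> g * cap g - 1 = cap g.
Proof. intros; unfold cap; field; lra. Qed.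

Lemma cap_gt_1 g : 1 < g < 2 -> 1 < cap g.
Proof. intros; unfold cap; rewrite <- Rinv_1; apply Rinv_lt_contravar; lra. Qed.

Lemma cap_continuous b eps : 1 < b -> 0 < eps ->
  exists del, 0 < del /\ forall g, Rabs (g - b) < del ->
    1 < g /\ Rabs (cap g - cap b) < eps.
Proof.
  intros Hb He.
  (* The first bound keeps [(g - 1) * (b - 1)] at least half of [(b - 1) * (b - 1)]; the second
     makes [b - g] smaller than [eps] times that half. *)
  exists (Rmin ((b - 1) / 2) (eps * ((b - 1) * (b - 1)) / 2)).
  assert (0 < (b - 1) * (b - 1)) by nra.
  split; [apply Rmin_glb_lt; nra|].
  intros g Hg.
  pose proof (Rmin_l ((b - 1) / 2) (eps * ((b - 1) * (b - 1)) / 2)).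
  pose proof (Rmin_r ((b - 1) / 2) (eps * ((b - 1) * (b - 1)) / 2)).
  set (m := Rmin _ _) in *. apply Rabs_def2 in Hg.
  assert (1 < g) by lra. split; [assumption|].
  assert (Hp : 0 < (g - 1) * (b - 1)) by nra.
  assert (E : cap g - cap b = (b - g) / ((g - 1) * (b - 1))) by (unfold cap; field; lra).
  rewrite E.
  assert (Hq : (b - 1) * (b - 1) / 2 <= (g - 1) * (b - 1)) by nra.
  apply Rabs_def1.
  - apply Rmult_lt_reg_r with (1 := Hp). unfold Rdiv. rewrite Rmult_assoc, Rinv_l by lra. nra.
  - apply Rmult_lt_reg_r with (1 := Hp). unfold Rdiv. rewrite Rmult_assoc, Rinv_l by lra. nra.
Qed.

Lemma pow_unbounded g M : 1 < g -> exists N, forall n, (N <= n)%nat -> M < g ^ n.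
Proof.
  intros Hg. destruct (Pow_x_infinity g) with (b := M + 1) as [N HN].
  { rewrite Rabs_pos_eq; lra. }
  exists N. intros n Hn. specialize (HN n Hn).
  rewrite Rabs_pos_eq in HN; [lra|]. apply pow_le; lra.
Qed.

(** A negative value grows in size by a factor of at least [g] at every step, so it would eventually
    fall below [- M]. *)
Lemma bounded_expanding_nonneg g (D : nat -> R) M : 1 < g ->
  (forall n, D (S n) <= g * D n) -> (forall n, - M <= D n) -> forall n, 0 <= D n.
Proof.
  intros Hg HD HM n. destruct (Rle_or_lt 0 (D n)) as [|Hn]; [assumption|exfalso].
  assert (Hk : forall k, D (k + n)%nat <= g ^ k * D n).
  { induction k as [|k IH]; simpl; [lra|]. specialize (HD (k + n)%nat). nra. }
  destruct (pow_unbounded g (M / - D n) Hg) as [N HN].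
  specialize (HN N (Nat.le_refl N)). specialize (Hk N). specialize (HM (N + n)%nat).
  apply Rmult_lt_compat_r with (r := - D n) in HN; [|lra].
  unfold Rdiv in HN. rewrite Rmult_assoc, Rinv_l in HN by lra. lra.
Qed.

Lemma geom_series g : 1 < g -> is_series (fun i => / g ^ S i) (cap g).
Proof.
  intros Hg.
  assert (Hq : Rabs (/ g) < 1).
  { rewrite Rabs_pos_eq; [rewrite <- Rinv_1; apply Rinv_lt_contravar; lra|].
    apply Rlt_le, Rinv_0_lt_compat; lra. }
  pose proof (is_series_scal_l (/ g) _ _ (is_series_geom (/ g) Hq)) as H.
  replace (cap g) with (scal (/ g) (/ (1 - / g))).
  - revert H; apply is_series_ext. intros n. unfold scal; simpl; unfold mult; simpl.
    rewrite pow_inv. field. split; [apply pow_nonzero|]; lra.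
  - unfold scal; simpl; unfold mult; simpl. unfold cap; field; lra.
Qed.

Lemma tail_term_bounds g a n i : 1 < g ->
  0 <= digit (a (n + i)%nat) / g ^ S i <= / g ^ S i.
Proof.
  intros Hg. pose proof (digit_bounds (a (n + i)%nat)).
  assert (0 < / g ^ S i) by (apply Rinv_0_lt_compat, pow_lt; lra).
  unfold Rdiv; nra.
Qed.

Lemma tail_ex_series g a n : 1 < g -> ex_series (fun i => digit (a (n + i)%nat) / g ^ S i).
Proof.
  intros Hg. apply (@ex_series_le R_AbsRing R_CompleteNormedModule _ (fun i => / g ^ S i)).
  - intros i. unfold norm; simpl; unfold abs; simpl. rewrite Rabs_pos_eq;
    apply (tail_term_bounds g a n i Hg).
  - exists (cap g). apply geom_series, Hg.
Qed.

Lemma tailval_bounds g a n : 1 < g -> 0 <= tailval g a n <= cap g.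
Proof.
  intros Hg. split.
  - replace 0 with (Series (fun i => 0 * (digit (a (n + i)%nat) / g ^ S i)))
      by (rewrite Series_scal_l; apply Rmult_0_l).
    apply Series_le; [|apply tail_ex_series, Hg].
    intros i. rewrite Rmult_0_l. split; [lra|apply tail_term_bounds, Hg].
  - rewrite <- (is_series_unique _ _ (geom_series g Hg)).
    apply Series_le; [intros; apply tail_term_bounds, Hg|].
    exists (cap g). apply geom_series, Hg.
Qed.

Lemma tailval_S g a n : 1 < g -> tailval g a (S n) = g * tailval g a n - digit (a n).
Proof.
  intros Hg. unfold tailval at 2. rewrite Series_incr_1 by (apply tail_ex_series, Hg).
  rewrite (Series_ext (fun k => digit (a (n + S k)%nat) / g ^ S (S k))
             (fun k => / g * (digit (a (S n + k)%nat) / g ^ S k))).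
  - rewrite Series_scal_l. fold (tailval g a (S n)). rewrite Nat.add_0_r. simpl. field. lra.
  - intros k. replace (n + S k)%nat with (S n + k)%nat by lia. simpl.
    field. split; [apply pow_nonzero|]; lra.
Qed.

Lemma tailval_ext g a b n m : (forall i, a (n + i)%nat = b (m + i)%nat) ->
  tailval g a n = tailval g b m.
Proof. intros H. apply Series_ext. intros i. rewrite H. reflexivity. Qed.

(* A bounded orbit of the expanding maps [x |-> g x - digit] is determined by
   its digits. *)
Lemma tailval_unique g a r M : 1 < g -> (forall n, r (S n) = g * r n - digit (a n)) ->
  (forall n, - M <= r n <= M) -> forall n, tailval g a n = r n.
Proof.
  intros Hg Hr HM n.
  assert (0 <= tailval g a n - r n).
  { revert n; apply (bounded_expanding_nonneg g (fun n => tailval g a n - r n) M Hg); intros n.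
    - rewrite tailval_S, Hr by assumption. lra.
    - pose proof (tailval_bounds g a n Hg); specialize (HM n); lra. }
  assert (0 <= r n - tailval g a n).
  { revert n H; intros n _; revert n.
    apply (bounded_expanding_nonneg g (fun n => r n - tailval g a n) (M + cap g) Hg); intros n.
    - rewrite tailval_S, Hr by assumption. lra.
    - pose proof (tailval_bounds g a n Hg); specialize (HM n); lra. }
  lra.
Qed.

Lemma tailval_compl g a n : 1 < g -> tailval g (compl a) n = cap g - tailval g a n.
Proof.
  intros Hg. revert n. apply (tailval_unique g _ (fun n => cap g - tailval g a n) (cap g) Hg).
  - intros n. rewrite tailval_S by assumption. pose proof (cap_fix g Hg).
    unfold compl. destruct (a n); simpl; lra.
  - intros n. pose proof (tailval_bounds g a n Hg). lra.
Qed.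

Lemma tailval_tail g k a n : tailval g (tail k a) n = tailval g a (k + n).
Proof. apply tailval_ext. intros i. unfold tail. f_equal; lia. Qed.

(** Equal digits cancel in the recursion, so each step only multiplies the difference by [g]. *)
Lemma tailval_agree g a b n : 1 < g -> agree n a b ->
  tailval g a n - tailval g b n = g ^ n * (tailval g a 0 - tailval g b 0).
Proof.
  intros Hg. induction n as [|n IH]; intros H; simpl; [lra|].
  rewrite !tailval_S by assumption. rewrite (H n) by lia.
  rewrite Rmult_assoc, <- IH; [lra|]. intros k Hk; apply H; lia.
Qed.

Lemma splice_agree n a d : agree n (splice n a d) a.
Proof. intros k Hk. unfold splice. apply Nat.ltb_lt in Hk. rewrite Hk. reflexivity. Qed.

Lemma splice_tail n a d i : splice n a d (n + i)%nat = d i.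
Proof.
  unfold splice. replace (n + i <? n)%nat with false by (symmetry; apply Nat.ltb_ge; lia).
  f_equal; lia.
Qed.

Lemma tailval_splice g n a d i : tailval g (splice n a d) (n + i) = tailval g d i.
Proof. apply tailval_ext. intros j. rewrite <- Nat.add_assoc. apply splice_tail. Qed.

Lemma expansion_value_tailval g a x : 1 < g ->
  (expansion_value g a x <-> x = tailval g a 0).
Proof.
  intros Hg.
  assert (H : expansion_value g a (tailval g a 0)).
  { apply is_series_Reals. apply (Series_correct _ (tail_ex_series g a 0 Hg)). }
  split; [|intros ->; exact H].
  intros H'. exact (uniqueness_sum _ _ _ H' H).
Qed.

Lemma expansion_exists g x : 1 < g < 2 -> 0 <= x <= cap g -> exists d, tailval g d 0 = x.
Proof.
  intros Hg Hx.
  (* The greedy map; it preserves [[0, cap g]] because [cap g > 1] and [g * cap g - 1 = cap g]. *)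
  set (f := fun y => if Rle_dec 1 (g * y) then g * y - 1 else g * y).
  set (r := fun n => Nat.iter n f x).
  assert (Hr : forall n, 0 <= r n <= cap g).
  { induction n as [|n IH]; [exact Hx|]. change (r (S n)) with (f (r n)). unfold f.
    pose proof (cap_fix g (proj1 Hg)). pose proof (cap_gt_1 g Hg).
    destruct (Rle_dec 1 (g * r n)); nra. }
  exists (fun n => if Rle_dec 1 (g * r n) then true else false).
  apply (tailval_unique g _ r (cap g) (proj1 Hg)).
  - intros n. change (r (S n)) with (f (r n)). unfold f.
    destruct (Rle_dec 1 (g * r n)); simpl; lra.
  - intros n. specialize (Hr n). lra.
Qed.

Lemma least_witness (P : nat -> Prop) : (exists n, P n) ->
  exists n, P n /\ forall k, (k < n)%nat -> ~ P k.
Proof.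
  intros H. destruct (dec_inh_nat_subset_has_unique_least_element P) as [n [[Hn Hl] _]];
    [intros; apply classic|assumption|].
  exists n. split; [assumption|]. intros k Hk HP. specialize (Hl k HP). lia.
Qed.

(** * Unique expansions characterised by their tails *)

Lemma first_difference (a b : bseq) : a <> b -> exists n, agree n a b /\ a n <> b n.
Proof.
  intros H.
  assert (Hex : exists n, a n <> b n).
  { apply not_all_ex_not. intros H'. apply H, functional_extensionality, H'. }
  destruct (least_witness _ Hex) as [n [Hn Hl]]. exists n. split; [|assumption].
  intros k Hk. apply NNPP, (Hl k Hk).
Qed.

Lemma univoque_compl g a : 1 < g -> univoque g a -> univoque g (compl a).
Proof.
  intros Hg H n. rewrite tailval_compl by assumption. unfold compl.
  destruct (H n) as [H0 H1]. destruct (a n); simpl; split; intros; try discriminate.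
  - specialize (H1 eq_refl). lra.
  - specialize (H0 eq_refl). lra.
Qed.

Lemma compl_involutive a : compl (compl a) = a.
Proof. apply functional_extensionality; intros n. apply Bool.negb_involutive. Qed.

Lemma univoque_tail g k a : univoque g a -> univoque g (tail k a).
Proof.
  intros H n. rewrite tailval_tail. replace (k + S n)%nat with (S (k + n)) by lia. apply H.
Qed.

Lemma univoque_cons_false g d : univoque g d -> tailval g d 0 < 1 ->
  univoque g (splice 1 (fun _ => false) d).
Proof.
  intros Hd Hv [|n].
  - rewrite (tailval_splice g 1 _ d 0 : tailval g _ 1 = _). split; [trivial|discriminate].
  - rewrite (tailval_splice g 1 _ d (S n) : tailval g _ (S (S n)) = _).
    rewrite (splice_tail 1 _ d n : splice 1 _ d (S n) = _). apply Hd.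
Qed.

Lemma Utilde_tailval g a : 1 < g ->
  (Utilde g a <-> forall b, tailval g b 0 = tailval g a 0 -> b = a).
Proof.
  intros Hg; split.
  - intros H b Hb. apply (H (tailval g a 0)); apply expansion_value_tailval; auto.
  - intros H x b Ha Hb. apply expansion_value_tailval in Ha, Hb; auto. apply H; congruence.
Qed.

Lemma Utilde_compl g a : 1 < g -> Utilde g a -> Utilde g (compl a).
Proof.
  intros Hg. rewrite !Utilde_tailval by assumption. intros H b Hb.
  rewrite <- (compl_involutive b). f_equal. apply H.
  rewrite tailval_compl in Hb |- * by assumption. lra.
Qed.

Lemma Utilde_after_false g a n : 1 < g < 2 -> Utilde g a -> a n = false ->
  tailval g a (S n) < 1.
Proof.
  intros Hg H Hn. rewrite Utilde_tailval in H by lra. apply Rnot_le_lt. intros Hv.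
  (* A tail of value at least 1 after a digit 0 lets that digit become 1, the rest being re-expanded
     with value one less; this yields a second expansion. *)
  destruct (expansion_exists g (tailval g a (S n) - 1) Hg) as [d Hd].
  { pose proof (tailval_bounds g a (S n) (proj1 Hg)). lra. }
  set (c := splice 1 (fun _ => true) d).
  set (b := splice n a c).
  assert (Hb : b = a).
  { apply H.
    pose proof (tailval_agree g b a n (proj1 Hg) (splice_agree n a c)) as E.
    assert (Ec : tailval g b n = tailval g a n).
    { rewrite <- (Nat.add_0_r n) at 1. unfold b. rewrite tailval_splice.
      pose proof (tailval_S g c 0 (proj1 Hg)) as E1. simpl in E1.
      unfold c at 1 in E1. rewrite (tailval_splice g 1 _ d 0 : tailval g _ 1 = _) in E1.
      rewrite Hd, tailval_S, Hn in E1 by lra. simpl in E1. nra. }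
    rewrite Ec in E. assert (0 < g ^ n) by (apply pow_lt; lra). nra. }
  assert (Hbn : b n = true).
  { rewrite <- (Nat.add_0_r n). unfold b. rewrite splice_tail. reflexivity. }
  congruence.
Qed.

Lemma Utilde_univoque g a : 1 < g < 2 -> (Utilde g a <-> univoque g a).
Proof.
  intros Hg; split.
  - intros H n. split; [apply Utilde_after_false; assumption|]. intros Hn.
    assert (Hc : tailval g (compl a) (S n) < 1).
    { apply Utilde_after_false; [assumption|apply Utilde_compl; [lra|assumption]|].
      unfold compl. rewrite Hn. reflexivity. }
    rewrite tailval_compl in Hc by lra. lra.
  - intros H. apply Utilde_tailval; [lra|]. intros b Hb. apply NNPP. intros Hne.
    (* At the first difference both tails still have equal value, so the next ones differ by 1 and
       the inequality for [a] pushes that of [b] outside [[0, cap g]]. *)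
    destruct (first_difference b a Hne) as [n [Hag Hn]].
    pose proof (tailval_agree g b a n (proj1 Hg) Hag) as E. rewrite Hb in E.
    pose proof (tailval_S g a n (proj1 Hg)). pose proof (tailval_S g b n (proj1 Hg)).
    pose proof (tailval_bounds g b (S n) (proj1 Hg)). destruct (H n) as [Hf Ht].
    assert (tailval g a n = tailval g b n) as Ev by lra. rewrite Ev in *.
    destruct (a n), (b n); simpl in *; try congruence;
      [specialize (Ht eq_refl)|specialize (Hf eq_refl)]; lra.
Qed.

Lemma in_U_intro g a : 1 < g < 2 -> univoque g a -> tailval g a 0 = 1 -> in_U g.
Proof.
  intros Hg Ha Hv. split; [assumption|]. exists a.
  assert (H1 : expansion_value g a 1) by (apply expansion_value_tailval; [lra|congruence]).
  split; [assumption|]. intros b. apply Utilde_univoque in Ha; [|assumption].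
  exact (Ha 1 b H1).
Qed.

Lemma in_U_elim g : in_U g -> 1 < g < 2 /\ exists a, univoque g a /\ tailval g a 0 = 1.
Proof.
  intros [Hg [a [Ha Hu]]]. split; [assumption|]. exists a.
  apply expansion_value_tailval in Ha; [|lra]. split; [|congruence].
  apply Utilde_univoque; [assumption|]. apply Utilde_tailval; [lra|].
  intros b Hb. apply Hu, expansion_value_tailval; [lra|congruence].
Qed.

(** * The quasi-greedy expansion of 1 *)

(** The strict comparison separates this from the greedy map: a product equal to 1 gets digit 0 and
    remainder 1, so remainders never reach 0. *)
Definition qg_map (beta x : R) : R := if Rlt_dec 1 (beta * x) then beta * x - 1 else beta * x.

Definition qg_rem (beta : R) (n : nat) : R := Nat.iter n (qg_map beta) 1.

Definition qg_digits (beta : R) : bseq :=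
  fun n => if Rlt_dec 1 (beta * qg_rem beta n) then true else false.

Lemma qg_rem_S beta n :
  qg_rem beta (S n) = beta * qg_rem beta n - digit (qg_digits beta n).
Proof.
  change (qg_rem beta (S n)) with (qg_map beta (qg_rem beta n)).
  unfold qg_map, qg_digits. destruct (Rlt_dec 1 (beta * qg_rem beta n)); simpl; lra.
Qed.

Lemma qg_rem_bounds beta n : 1 < beta < 2 -> 0 < qg_rem beta n <= 1.
Proof.
  intros Hb. induction n as [|n IH]; [unfold qg_rem; simpl; lra|].
  change (qg_rem beta (S n)) with (qg_map beta (qg_rem beta n)).
  unfold qg_map. destruct (Rlt_dec 1 (beta * qg_rem beta n)); nra.
Qed.

Lemma qg_digits_0 beta : 1 < beta -> qg_digits beta 0%nat = true.
Proof.
  intros Hb. unfold qg_digits.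
  destruct (Rlt_dec 1 (beta * qg_rem beta 0)) as [|H]; [reflexivity|].
  unfold qg_rem in H; simpl in H; lra.
Qed.

Lemma qg_rem_1 beta : 1 < beta -> qg_rem beta 1 = beta - 1.
Proof.
  intros Hb. rewrite qg_rem_S, qg_digits_0 by assumption. unfold qg_rem; simpl; lra.
Qed.

Lemma qg_rem_period beta p n : qg_rem beta p = 1 -> qg_rem beta (n + p) = qg_rem beta n.
Proof. intros H. unfold qg_rem in *. rewrite Nat.iter_add, H. reflexivity. Qed.

Lemma qg_rem_multiple beta p k : qg_rem beta p = 1 -> qg_rem beta (k * p) = 1.
Proof.
  intros H. induction k as [|k IH]; [reflexivity|].
  simpl. rewrite Nat.add_comm, qg_rem_period; assumption.
Qed.

Lemma qg_digits_period beta p n : qg_rem beta p = 1 ->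
  qg_digits beta (n + p)%nat = qg_digits beta n.
Proof. intros H. unfold qg_digits. rewrite qg_rem_period by assumption. reflexivity. Qed.

Lemma tailval_qg beta n : 1 < beta < 2 -> tailval beta (qg_digits beta) n = qg_rem beta n.
Proof.
  intros Hb. apply (tailval_unique beta _ (qg_rem beta) 1); [lra|apply qg_rem_S|].
  intros k. pose proof (qg_rem_bounds beta k Hb). lra.
Qed.

(** * Consequences of a remainder at most [cap beta - 1] *)

(** By induction [g] times the k-th tail is near [beta * qg_rem beta k], which is not 1. Above 1 a
    digit 0 would break univoqueness, below 1 a digit 1 would leave a negative tail, so the digit is
    forced. *)
Lemma univoque_prefix_near_1 beta k : 1 < beta < 2 ->
  (forall j, (1 <= j <= k)%nat -> qg_rem beta j < 1) ->
  forall eps, 0 < eps -> exists del, 0 < del /\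
    forall g a, 1 < g < 2 -> Rabs (g - beta) < del -> univoque g a ->
      Rabs (tailval g a 0 - 1) < del ->
      agree k a (qg_digits beta) /\ Rabs (tailval g a k - qg_rem beta k) < eps.
Proof.
  intros Hb. induction k as [|k IH]; intros Hr eps He.
  { exists eps. split; [assumption|]. intros g a _ _ _ Hv.
    split; [intros j Hj; lia|exact Hv]. }
  pose proof (qg_rem_bounds beta k Hb) as Hk. pose proof (qg_rem_S beta k) as Hs.
  assert (Hgap : beta * qg_rem beta k <> 1).
  { intros E. assert (qg_rem beta (S k) < 1) by (apply Hr; lia).
    unfold qg_digits in Hs. destruct (Rlt_dec 1 (beta * qg_rem beta k)); simpl digit in Hs; lra. }
  (* An error below [e] cannot cross 1. Precision [e / 4] suffices: the tail error costs at most
     [e / 2] since [g < 2], and the change of base at most [e / 4]. *)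
  set (e := Rmin eps (Rabs (beta * qg_rem beta k - 1))).
  assert (He0 : 0 < e) by (apply Rmin_glb_lt; [assumption|apply Rabs_pos_lt; lra]).
  assert (He1 : e <= eps) by apply Rmin_l.
  assert (He2 : e <= Rabs (beta * qg_rem beta k - 1)) by apply Rmin_r.
  destruct (IH (fun j Hj => Hr j ltac:(lia)) (e / 4)) as [del [Hd H]]; [lra|].
  exists (Rmin del (e / 4)). split; [apply Rmin_glb_lt; lra|].
  intros g a Hg Hgb Ha Hv.
  assert (Hgb1 := Rlt_le_trans _ _ _ Hgb (Rmin_l _ _)).
  assert (Hgb2 := Rlt_le_trans _ _ _ Hgb (Rmin_r _ _)).
  assert (Hv1 := Rlt_le_trans _ _ _ Hv (Rmin_l _ _)).
  destruct (H g a Hg Hgb1 Ha Hv1) as [Hag Hc].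
  assert (Hm : Rabs (g * tailval g a k - beta * qg_rem beta k) < e).
  { apply Rabs_def2 in Hgb2, Hc.
    assert (- (e / 2) < g * (tailval g a k - qg_rem beta k) < e / 2) by (split; nra).
    assert (- (e / 4) <= (g - beta) * qg_rem beta k <= e / 4) by (split; nra).
    apply Rabs_def1; lra. }
  pose proof (tailval_S g a k (proj1 Hg)) as Ht.
  assert (Hd' : a k = qg_digits beta k).
  { unfold qg_digits. destruct (Ha k) as [Hf Htr].
    pose proof (tailval_bounds g a (S k) (proj1 Hg)).
    apply Rabs_def2 in Hm.
    destruct (Rlt_dec 1 (beta * qg_rem beta k)).
    - rewrite Rabs_pos_eq in He2 by lra.
      destruct (a k); [reflexivity|]. specialize (Hf eq_refl). simpl in Ht. lra.
    - rewrite Rabs_left in He2 by lra.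
      destruct (a k); [|reflexivity]. simpl in Ht. lra. }
  split.
  - intros j Hj. destruct (Nat.eq_dec j k) as [->|]; [assumption|]. apply Hag; lia.
  - rewrite Ht, Hs, Hd'. apply Rabs_def2 in Hm. apply Rabs_def1; lra.
Qed.

(** Take the least index. A digit 0 just before it would mean a still smaller previous remainder,
    and an earlier remainder equal to 1 would restart the orbit and give a smaller index. *)
Lemma least_small_remainder beta : 1 < beta < 2 ->
  (exists k, (1 <= k)%nat /\ qg_rem beta k <= cap beta - 1) ->
  exists k, qg_rem beta (S k) <= cap beta - 1 /\ qg_digits beta k = true /\
    forall j, (1 <= j <= S k)%nat -> qg_rem beta j < 1.
Proof.
  intros Hb Hex. destruct (least_witness _ Hex) as [[|k] [[Hk1 Hk] Hl]]; [lia|].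
  exists k. split; [assumption|].
  assert (Hl' : forall j, (1 <= j <= k)%nat -> cap beta - 1 < qg_rem beta j).
  { intros j Hj. apply Rnot_le_lt. intros H. apply (Hl j); [lia|]. split; [lia|exact H]. }
  split.
  - destruct k as [|k]; [apply qg_digits_0; lra|].
    destruct (qg_digits beta (S k)) eqn:E; [reflexivity|exfalso].
    pose proof (qg_rem_S beta (S k)) as H. rewrite E in H. simpl digit in H.
    specialize (Hl' (S k) ltac:(lia)). pose proof (qg_rem_bounds beta (S k) Hb). nra.
  - intros j Hj. destruct (proj2 (qg_rem_bounds beta j Hb)) as [|E]; [assumption|exfalso].
    destruct (Nat.eq_dec j (S k)) as [->|Hne].
    + destruct k as [|k].
      * rewrite qg_rem_1 in E by lra. lra.
      * specialize (Hl' 1%nat ltac:(lia)). rewrite qg_rem_1 in Hl' by lra. lra.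
    + specialize (Hl' (S k - j)%nat ltac:(lia)).
      rewrite <- (qg_rem_period beta j _ E) in Hl'.
      replace (S k - j + j)%nat with (S k) in Hl' by lia. lra.
Qed.

Lemma small_remainder_not_closure beta : 1 < beta < 2 ->
  (exists k, (1 <= k)%nat /\ qg_rem beta k <= cap beta - 1) -> ~ in_closure_U beta.
Proof.
  intros Hb Hex Hcl. destruct (least_small_remainder beta Hb Hex) as [k [Hk [Hdig Hr]]].
  pose proof (univoque_prefix_near_1 beta (S k) Hb Hr) as L.
  (* Half of [d1] is allowed for the tail of [a] and half for [cap g], so that the value of [b]
     below lies within [d1] of 1. *)
  destruct (L 1 ltac:(lra)) as [d1 [Hd1 L1]].
  destruct (L (d1 / 2) ltac:(lra)) as [d2 [Hd2 L2]].
  destruct (cap_continuous beta (d1 / 2) (proj1 Hb) ltac:(lra)) as [d3 [Hd3 L3]].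
  destruct (Hcl (Rmin d1 (Rmin d2 d3))) as [g [Hg Hgb]]; [repeat apply Rmin_glb_lt; lra|].
  assert (Hg1 := Rlt_le_trans _ _ _ Hgb (Rmin_l _ _)).
  assert (Hg23 := Rlt_le_trans _ _ _ Hgb (Rmin_r _ _)).
  assert (Hg2 := Rlt_le_trans _ _ _ Hg23 (Rmin_l _ _)).
  assert (Hg3 := Rlt_le_trans _ _ _ Hg23 (Rmin_r _ _)).
  destruct (in_U_elim g Hg) as [Hg' [a [Ha Hv]]].
  destruct (L2 g a Hg' Hg2 Ha) as [Hag Hc]; [rewrite Hv, Rminus_diag, Rabs_R0; lra|].
  destruct (L3 g Hg3) as [_ Hcap]. apply Rabs_def2 in Hc, Hcap.
  assert (Heta : cap g - 1 < tailval g a (S k)).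
  { apply (Ha k). rewrite Hag by lia. exact Hdig. }
  (* The complement [b] of the k-th tail of [a] has value just below 1, hence
     starts like [a]; the expansion of the distance between [a] and [b] then
     pushes the tails of [b] below the univoque threshold. *)
  set (b := compl (tail (S k) a)).
  assert (Hbu : univoque g b) by (apply univoque_compl, univoque_tail; [lra|assumption]).
  assert (Hb0 : tailval g b 0 = cap g - tailval g a (S k)).
  { unfold b. rewrite tailval_compl, tailval_tail, Nat.add_0_r by lra. reflexivity. }
  destruct (L1 g b Hg' Hg1 Hbu) as [Hbg _]; [rewrite Hb0; apply Rabs_def1; lra|].
  assert (Hab : agree (S k) a b).
  { intros j Hj. rewrite Hag, Hbg by assumption. reflexivity. }
  pose proof (tailval_agree g a b (S k) (proj1 Hg') Hab) as E.
  assert (cap g - 1 < tailval g b (S k)).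
  { apply (Hbu k). rewrite Hbg by lia. exact Hdig. }
  (* With [delta = 1 - tailval g b 0 > 0], [E] puts the tail of [b] at
     [cap g - 1 - (g ^ S k - 1) * delta], a contradiction. *)
  assert (1 <= g ^ k) by (apply pow_R1_Rle; lra).
  assert (1 < g ^ S k) by (simpl; nra).
  rewrite Hv, Hb0 in E. nra.
Qed.

Lemma small_remainder_gap beta : 1 < beta < 2 ->
  (exists k, (1 <= k)%nat /\ qg_rem beta k <= cap beta - 1) ->
  exists del, 0 < del /\ forall d, univoque beta d -> tailval beta d 0 < 1 ->
    tailval beta d 0 <= 1 - del.
Proof.
  intros Hb Hex. destruct (least_small_remainder beta Hb Hex) as [k [Hk [Hdig Hr]]].
  destruct (univoque_prefix_near_1 beta (S k) Hb Hr 1 ltac:(lra)) as [del [Hd L]].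
  exists del. split; [assumption|]. intros d Hu Hv. apply Rnot_lt_le. intros Hlt.
  destruct (L beta d Hb) as [Hag _]; [rewrite Rminus_diag, Rabs_R0; lra|assumption| |].
  { apply Rabs_def1; lra. }
  pose proof (tailval_agree beta d _ (S k) (proj1 Hb) Hag) as E.
  rewrite !tailval_qg in E by assumption. unfold qg_rem at 2 in E; simpl Nat.iter in E.
  assert (cap beta - 1 < tailval beta d (S k)).
  { apply (Hu k). rewrite Hag by lia. exact Hdig. }
  assert (0 < beta ^ S k) by (apply pow_lt; lra). nra.
Qed.

(** * From a gap below 1 to finite type *)

Lemma list_comprehension {A : Type} (P : A -> Prop) (l : list A) :
  exists l', forall x, In x l' <-> In x l /\ P x.
Proof.
  induction l as [|y l [l' Hl']]; [exists nil; simpl; tauto|].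
  destruct (classic (P y)) as [Hy|Hy]; [exists (y :: l')|exists l'];
    intros x; simpl; rewrite Hl'; intuition congruence.
Qed.

Lemma all_words (n : nat) : exists l : list (list bool), forall w, In w l <-> length w = n.
Proof.
  induction n as [|n [l Hl]].
  - exists (nil :: nil). intros [|b w]; simpl; intuition discriminate.
  - exists (map (cons true) l ++ map (cons false) l). intros w.
    rewrite in_app_iff, !in_map_iff. split.
    + intros [[v [<- Hv]]|[v [<- Hv]]]; simpl; f_equal; apply Hl, Hv.
    + destruct w as [|[|] w]; simpl; intros H; [discriminate| |];
        injection H as H; apply Hl in H; [left|right]; exists w; auto.
Qed.

Definition window (N i : nat) (x : bseq) : list bool := map (fun k => x (i + k)%nat) (seq 0 N).

Lemma window_length N i x : length (window N i x) = N.
Proof. unfold window. rewrite length_map, length_seq. reflexivity. Qed.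

Lemma window_nth N i x k d : (k < N)%nat -> nth k (window N i x) d = x (i + k)%nat.
Proof.
  intros Hk. rewrite (nth_indep _ d (x (i + 0)%nat)) by (rewrite window_length; assumption).
  unfold window. rewrite (map_nth (fun k => x (i + k)%nat)), seq_nth by assumption. reflexivity.
Qed.

Lemma window_occurs N i x : occurs (window N i x) x.
Proof.
  exists i. intros k Hk d. rewrite window_length in Hk. rewrite window_nth by assumption.
  reflexivity.
Qed.

(** The forbidden words are those of length [N] that occur in no element of [Y]. *)
Lemma SFT_of_locally_determined (Y : bseq -> Prop) (N : nat) :
  (forall x, (forall n, exists y i, Y y /\ agree N (tail n x) (tail i y)) -> Y x) ->
  is_SFT Y.
Proof.
  intros H. destruct (all_words N) as [l Hl].
  destruct (list_comprehension (fun w => forall y, Y y -> ~ occurs w y) l) as [F HF].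
  exists F. intros x. split.
  - intros Hx w Hw. apply HF in Hw. apply (proj2 Hw x Hx).
  - intros Hx. apply H. intros n. apply NNPP. intros Hno.
    apply (Hx (window N n x)); [|apply window_occurs].
    apply HF. split; [apply Hl, window_length|]. intros y Hy [i Hi].
    apply Hno. exists y, i. split; [assumption|]. intros k Hk. unfold tail.
    rewrite Hi with (d := false) by (rewrite window_length; assumption).
    rewrite window_nth by assumption. reflexivity.
Qed.

Lemma tailval_agree_le g a b n : 1 < g -> agree n a b ->
  tailval g a 0 - tailval g b 0 <= cap g / g ^ n.
Proof.
  intros Hg H. pose proof (tailval_agree g a b n Hg H) as E.
  pose proof (tailval_bounds g a n Hg). pose proof (tailval_bounds g b n Hg).
  assert (Hp : 0 < g ^ n) by (apply pow_lt; lra).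
  apply Rmult_le_reg_l with (1 := Hp). unfold Rdiv.
  replace (g ^ n * (cap g * / g ^ n)) with (cap g) by (field; lra). lra.
Qed.

Lemma gap_SFT beta del : 1 < beta < 2 -> 0 < del ->
  (forall d, univoque beta d -> tailval beta d 0 < 1 -> tailval beta d 0 <= 1 - del) ->
  is_SFT (Utilde beta).
Proof.
  intros Hb Hd Hgap. destruct (pow_unbounded beta (cap beta / del) (proj1 Hb)) as [N HN].
  specialize (HN N (Nat.le_refl N)).
  assert (HN' : cap beta / beta ^ N < del).
  { assert (0 < beta ^ N) by (apply pow_lt; lra).
    apply Rmult_lt_compat_r with (r := del / beta ^ N) in HN.
    - revert HN. unfold Rdiv. intros HN.
      replace (cap beta * / beta ^ N) with (cap beta * / del * (del * / beta ^ N)) by (field; lra).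
      replace del with (beta ^ N * (del * / beta ^ N)) at 3 by (field; lra). exact HN.
    - apply Rdiv_lt_0_compat; assumption. }
  (* Both digits at once: after complementing, the first digit of the window is 0. *)
  assert (Hloc : forall y z, univoque beta y -> agree (S N) z y -> y 0%nat = false ->
                   tailval beta z 1 < 1).
  { intros y z Hy Hag H0.
    pose proof (Hgap (tail 1 y) (univoque_tail _ _ _ Hy)) as G.
    rewrite tailval_tail in G. specialize (G (proj1 (Hy 0%nat) H0)). simpl in G.
    pose proof (tailval_agree_le beta (tail 1 z) (tail 1 y) N (proj1 Hb)) as E.
    rewrite !tailval_tail in E. simpl in E.
    assert (tailval beta z 1 - tailval beta y 1 <= cap beta / beta ^ N); [|lra].
    apply E. intros k Hk. apply (Hag (S k)). lia. }
  apply (SFT_of_locally_determined _ (S N)). intros x Hx.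
  apply Utilde_univoque; [assumption|]. intros n.
  destruct (Hx n) as [y [i [Hy Hag]]]. apply Utilde_univoque in Hy; [|assumption].
  apply (univoque_tail _ i) in Hy.
  assert (Ht : tailval beta (tail n x) 1 = tailval beta x (S n)).
  { rewrite tailval_tail. f_equal. lia. }
  assert (Hxy : x n = tail i y 0%nat).
  { rewrite <- Hag by lia. unfold tail. f_equal. lia. }
  split; intros Hn; rewrite <- Ht.
  - apply (Hloc _ _ Hy Hag). congruence.
  - assert (tailval beta (compl (tail n x)) 1 < 1); [|rewrite tailval_compl in H by lra; lra].
    apply (Hloc (compl (tail i y))).
    + apply univoque_compl; [lra|assumption].
    + intros k Hk. unfold compl. rewrite Hag by assumption. reflexivity.
    + unfold compl. rewrite <- Hxy, Hn. reflexivity.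
Qed.

(** * Approximating sequences when all remainders are large *)

Lemma finite_positive_min (f : nat -> R) n : (forall k, 0 < f k) ->
  exists mu, 0 < mu /\ forall k, (k <= n)%nat -> mu <= f k.
Proof.
  intros Hf. induction n as [|n [mu [Hmu H]]].
  - exists (f O). split; [apply Hf|]. intros k Hk. replace k with O by lia. lra.
  - exists (Rmin mu (f (S n))). split; [apply Rmin_glb_lt; auto|]. intros k Hk.
    destruct (Nat.eq_dec k (S n)) as [->|]; [apply Rmin_r|].
    apply Rle_trans with mu; [apply Rmin_l|]. apply H; lia.
Qed.

Lemma periodic_positive_min (f : nat -> R) p : (0 < p)%nat -> (forall k, 0 < f k) ->
  (forall k, f (k + p)%nat = f k) -> exists mu, 0 < mu /\ forall k, mu <= f k.
Proof.
  intros Hp Hf Hper. destruct (finite_positive_min f p Hf) as [mu [Hmu H]].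
  exists mu. split; [assumption|]. intros k.
  induction k as [k IH] using (well_founded_induction lt_wf).
  destruct (Nat.le_gt_cases k p) as [|Hk]; [apply H; assumption|].
  replace k with (k - p + p)%nat by lia. rewrite Hper. apply IH. lia.
Qed.

Lemma exists_record (f : nat -> R) n eps : 0 < eps -> (forall k, 0 < f k) ->
  (forall e, 0 < e -> exists k, f k < e) ->
  exists m, (n < m)%nat /\ f m < eps /\ forall j, (j <= m)%nat -> f m <= f j.
Proof.
  intros He Hf Hlim. destruct (finite_positive_min f n Hf) as [mu [Hmu H]].
  (* The first drop below [Rmin mu eps] is a record, and it comes after [n] because [mu] bounds [f]
     from below up to [n]. *)
  destruct (least_witness (fun k => f k < Rmin mu eps)) as [m [Hm Hl]].
  { apply Hlim, Rmin_glb_lt; assumption. }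
  pose proof (Rmin_l mu eps). pose proof (Rmin_r mu eps).
  exists m. split; [|split; [lra|]].
  - apply Nat.nle_gt. intros Hmn. specialize (H m Hmn). lra.
  - intros j Hj. destruct (Nat.eq_dec j m) as [->|]; [lra|].
    specialize (Hl j ltac:(lia)). lra.
Qed.

(* The state [(i, b)] says that the next digit of (u u~)^oo, where u is a word of
   length m and u~ its complement, is the i-th letter of u, complemented if [b]. *)
Fixpoint refl_state (m n : nat) : nat * bool :=
  match n with
  | O => (O, false)
  | S n' => let (i, b) := refl_state m n' in
            if (S i =? m)%nat then (O, negb b) else (S i, b)
  end.

Definition refl_seq (a : bseq) (m : nat) : bseq :=
  fun n => let (i, b) := refl_state m n in xorb b (a i).

Lemma refl_state_small m n : (n < m)%nat -> refl_state m n = (n, false).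
Proof.
  induction n as [|n IH]; intros Hn; [reflexivity|]. cbn [refl_state]. rewrite IH by lia.
  replace (S n =? m)%nat with false by (symmetry; apply Nat.eqb_neq; lia). reflexivity.
Qed.

Lemma refl_seq_agree a m : agree m (refl_seq a m) a.
Proof.
  intros n Hn. unfold refl_seq. rewrite refl_state_small by assumption.
  destruct (a n); reflexivity.
Qed.

Lemma refl_state_lt m n : (0 < m)%nat -> (fst (refl_state m n) < m)%nat.
Proof.
  intros Hm. induction n as [|n IH]; [assumption|]. cbn [refl_state].
  destruct (refl_state m n) as [i b]. simpl in IH.
  destruct (Nat.eqb_spec (S i) m); simpl; lia.
Qed.

(** The condition on [s m] makes the orbit continue at the complement of its start once u is read,
    which closes the cycle. Only the values of [s] up to [m] occur, so they are bounded. *)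
Lemma tailval_refl_seq g a m (s : nat -> R) n : 1 < g -> (0 < m)%nat ->
  (forall i, s (S i) = g * s i - digit (a i)) -> s m = cap g - s O ->
  tailval g (refl_seq a m) n =
    let (i, b) := refl_state m n in if b then cap g - s i else s i.
Proof.
  intros Hg Hm Hs Hsm. pose proof (cap_fix g Hg) as Hc.
  set (t := fun n => let (i, b) := refl_state m n in if b then cap g - s i else s i).
  assert (HB : exists B, forall i, (i <= m)%nat -> Rabs (s i) <= B).
  { clear. induction m as [|m [B HB]].
    - exists (Rabs (s O)). intros i Hi. replace i with O by lia. lra.
    - exists (Rmax B (Rabs (s (S m)))). intros i Hi.
      destruct (Nat.eq_dec i (S m)) as [->|]; [apply Rmax_r|].
      apply Rle_trans with B; [apply HB; lia|apply Rmax_l]. }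
  destruct HB as [B HB].
  apply (tailval_unique g _ t (B + cap g) Hg); clear n.
  - intros n. unfold t, refl_seq. cbn [refl_state]. pose proof (refl_state_lt m n Hm) as Hi.
    destruct (refl_state m n) as [i b]. simpl in Hi. specialize (Hs i).
    destruct (Nat.eqb_spec (S i) m) as [E|E];
      [rewrite <- E, Hs in Hsm|]; destruct b; simpl negb; cbv iota;
      rewrite ?Hs; destruct (a i); simpl digit in *; lra.
  - intros n. unfold t. pose proof (refl_state_lt m n Hm) as Hi.
    destruct (refl_state m n) as [i b]. simpl in Hi.
    pose proof (HB i ltac:(lia)) as H. pose proof (cap_pos g Hg).
    pose proof (Rle_abs (s i)). pose proof (Rle_abs (- s i)) as H'.
    rewrite Rabs_Ropp in H'. destruct b; lra.
Qed.

(** Lowering the initial value by [sig] lowers the n-th tail by [beta ^ n * sig]; this is the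
    largest [sig] that keeps that tail at least [cap beta - 1]. *)
Definition excess (beta : R) (n : nat) : R := (qg_rem beta n - (cap beta - 1)) / beta ^ n.

Definition large_remainders (beta : R) : Prop :=
  forall k, (1 <= k)%nat -> cap beta - 1 < qg_rem beta k.

Lemma large_remainder beta n : 1 < beta < 2 -> large_remainders beta ->
  cap beta - 1 < qg_rem beta n.
Proof.
  intros Hb Hl.
  destruct n as [|n]; [|apply Hl; lia].
  pose proof (Hl 1%nat ltac:(lia)) as H. rewrite qg_rem_1 in H by lra.
  change (qg_rem beta 0) with 1. lra.
Qed.

Lemma excess_pos beta n : 1 < beta < 2 -> large_remainders beta -> 0 < excess beta n.
Proof.
  intros Hb Hl. pose proof (large_remainder beta n Hb Hl). apply Rdiv_lt_0_compat; [lra|apply pow_lt; lra].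
Qed.

Lemma excess_pow beta n : 1 < beta ->
  beta ^ n * excess beta n = qg_rem beta n - (cap beta - 1).
Proof. intros Hb. unfold excess. field. apply pow_nonzero; lra. Qed.

Lemma excess_record beta n eps : 1 < beta < 2 -> large_remainders beta -> 0 < eps ->
  exists m, (n < m)%nat /\ excess beta m < eps /\
  forall j, (j <= m)%nat -> excess beta m <= excess beta j.
Proof.
  intros Hb Hl He. apply exists_record; [assumption|intros; apply excess_pos; assumption|].
  intros e He'.
  destruct (pow_unbounded beta (1 / e) (proj1 Hb)) as [N HN].
  specialize (HN N (Nat.le_refl N)). exists N.
  pose proof (excess_pow beta N (proj1 Hb)). pose proof (qg_rem_bounds beta N Hb).
  pose proof (cap_gt_1 beta Hb). apply Rnot_le_lt. intros Hle.
  apply Rmult_lt_compat_r with (r := e) in HN; [|assumption].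
  unfold Rdiv in HN. rewrite Rmult_assoc, Rinv_l in HN by lra.
  assert (0 < beta ^ N) by (apply pow_lt; lra). nra.
Qed.

(* With u the length-m prefix of the quasi-greedy expansion of 1, the tails of
   (u u~)^oo are the remainders lowered by [beta ^ i * sig]; the record property
   of m is what keeps them above [cap beta - 1]. *)
Lemma univoque_approximation beta n eps : 1 < beta < 2 -> large_remainders beta -> 0 < eps ->
  exists e del,
  agree n e (qg_digits beta) /\ 1 - eps < tailval beta e 0 /\ 0 < del /\
  forall k, cap beta - 1 + del <= tailval beta e k <= 1 - del.
Proof.
  intros Hb Hl He. destruct (excess_record beta n eps Hb Hl He) as [m [Hnm [Hm Hrec]]].
  pose proof (excess_pos beta m Hb Hl) as Hem. pose proof (excess_pow beta m (proj1 Hb)) as Hpm.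
  assert (Hbm : 0 < beta ^ m) by (apply pow_lt; lra).
  (* The solution of [s m = cap beta - s O] for the sequence [s] below. *)
  set (sig := beta ^ m * excess beta m / (1 + beta ^ m)).
  assert (Hsig : sig * (1 + beta ^ m) = beta ^ m * excess beta m) by (unfold sig; field; lra).
  assert (Hs0 : 0 < sig) by (apply Rdiv_lt_0_compat; nra).
  assert (Hs1 : sig < excess beta m) by nra.
  set (s := fun i => qg_rem beta i - beta ^ i * sig).
  assert (HsS : forall i, s (S i) = beta * s i - digit (qg_digits beta i)).
  { intros i. unfold s. rewrite qg_rem_S. simpl. lra. }
  assert (Hs00 : s O = 1 - sig) by (unfold s, qg_rem; simpl; lra).
  assert (Hsm : s m = cap beta - s O) by (rewrite Hs00; unfold s; lra).
  assert (Hlow : forall i, (i <= m)%nat -> cap beta - 1 < s i).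
  { intros i Hi. pose proof (excess_pow beta i (proj1 Hb)). pose proof (Hrec i Hi). unfold s.
    assert (0 < beta ^ i) by (apply pow_lt; lra). nra. }
  assert (Hup : forall i, s i < 1).
  { intros i. pose proof (qg_rem_bounds beta i Hb). unfold s.
    assert (0 < beta ^ i) by (apply pow_lt; lra). nra. }
  (* The value 1 beyond [m] is a filler: the lower bound [Hlow] is available only up to [m]. *)
  destruct (finite_positive_min
              (fun i => if (i <=? m)%nat then Rmin (s i - (cap beta - 1)) (1 - s i) else 1) m)
    as [del [Hdel Hmin]].
  { intros i. destruct (Nat.leb_spec i m); [|lra].
    specialize (Hlow i ltac:(assumption)). specialize (Hup i). apply Rmin_glb_lt; lra. }
  pose proof (fun k => tailval_refl_seq beta (qg_digits beta) m s k (proj1 Hb) ltac:(lia) HsS Hsm)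
    as Hval.
  exists (refl_seq (qg_digits beta) m), del. split; [|split; [|split; [assumption|]]].
  - intros k Hk. apply refl_seq_agree. lia.
  - rewrite Hval. cbn. lra.
  - intros k. rewrite Hval. pose proof (refl_state_lt m k ltac:(lia)) as Hi.
    destruct (refl_state m k) as [i b]. simpl in Hi. specialize (Hmin i ltac:(lia)). simpl in Hmin.
    replace (i <=? m)%nat with true in Hmin by (symmetry; apply Nat.leb_le; lia).
    pose proof (Rmin_l (s i - (cap beta - 1)) (1 - s i)).
    pose proof (Rmin_r (s i - (cap beta - 1)) (1 - s i)).
    destruct b; lra.
Qed.

Lemma large_remainders_not_closed beta : 1 < beta < 2 -> large_remainders beta ->
  ~ is_closed (Utilde beta).
Proof.
  intros Hb Hl Hcl.
  assert (H : univoque beta (splice 1 (fun _ => false) (qg_digits beta))).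
  { apply Utilde_univoque; [assumption|]. apply Hcl. intros n.
    destruct (univoque_approximation beta n 1 Hb Hl ltac:(lra)) as [e [del [Hag [_ [Hdel He]]]]].
    exists (splice 1 (fun _ => false) e). split.
    - apply Utilde_univoque; [assumption|]. apply univoque_cons_false.
      + intros k. specialize (He (S k)). split; intros _; lra.
      + specialize (He O). lra.
    - intros [|k] Hk; [reflexivity|].
      rewrite !(splice_tail 1 _ _ k : splice 1 _ _ (S k) = _). symmetry. apply Hag. lia. }
  pose proof (proj1 (H O) eq_refl) as H0.
  rewrite (tailval_splice beta 1 _ _ 0 : tailval beta _ 1 = _), tailval_qg in H0 by assumption.
  unfold qg_rem in H0; simpl in H0; lra.
Qed.

(** * Dependence of tail values on the base *)

Lemma tailval_base_mono g h a n : 1 < g <= h -> tailval h a n <= tailval g a n.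
Proof.
  intros Hg. enough (0 <= tailval g a n - tailval h a n) by lra. revert n.
  apply (bounded_expanding_nonneg g (fun n => tailval g a n - tailval h a n) (cap h)); [lra| |].
  - intros n. rewrite !tailval_S by lra. pose proof (tailval_bounds h a n ltac:(lra)). nra.
  - intros n. pose proof (tailval_bounds h a n ltac:(lra)).
    pose proof (tailval_bounds g a n ltac:(lra)). lra.
Qed.

(** Monotonicity applied to the complement; the bound is uniform in the sequence and the index. *)
Lemma tailval_base_bound g h a n : 1 < g <= h ->
  tailval g a n - tailval h a n <= cap g - cap h.
Proof.
  intros Hg. pose proof (tailval_base_mono g h (compl a) n Hg) as H.
  rewrite !tailval_compl in H by lra. lra.
Qed.

Lemma tailval_base_continuous a n b : 1 < b -> continuity_pt (fun g => tailval g a n) b.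
Proof.
  intros Hb eps He. destruct (cap_continuous b eps Hb He) as [del [Hd H]].
  exists del. split; [assumption|]. intros g [_ Hg].
  unfold dist in *; simpl in *; unfold R_dist in *.
  destruct (H g Hg) as [Hg1 Hc]. apply Rabs_def2 in Hc.
  destruct (Rle_or_lt g b) as [Hle|Hlt].
  - pose proof (tailval_base_mono g b a n ltac:(lra)).
    pose proof (tailval_base_bound g b a n ltac:(lra)). apply Rabs_def1; lra.
  - pose proof (tailval_base_mono b g a n ltac:(lra)).
    pose proof (tailval_base_bound b g a n ltac:(lra)). apply Rabs_def1; lra.
Qed.

(** The first tail is at least its value [beta - 1] in base [beta], so the whole value is at least
    [beta / g]. *)
Lemma qg_value_smaller_base g beta : 1 < g < beta -> beta < 2 ->
  1 < tailval g (qg_digits beta) 0.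
Proof.
  intros Hg Hb2. pose proof (tailval_base_mono g beta (qg_digits beta) 1 ltac:(lra)) as H.
  rewrite tailval_qg, qg_rem_1 in H by lra.
  rewrite tailval_S, qg_digits_0 in H by lra. simpl in H. nra.
Qed.

Lemma tailval_qg_period g beta n : qg_rem beta n = 1 ->
  tailval g (qg_digits beta) n = tailval g (qg_digits beta) 0.
Proof.
  intros Hn. apply tailval_ext. intros i. rewrite Nat.add_comm.
  apply qg_digits_period, Hn.
Qed.

(** * Large remainders put [beta] in the closure of U *)

Lemma aperiodic_in_U beta : 1 < beta < 2 ->
  large_remainders beta ->
  (forall k, (1 <= k)%nat -> qg_rem beta k <> 1) -> in_U beta.
Proof.
  intros Hb Hl Hap. apply (in_U_intro beta (qg_digits beta)); [assumption| |].
  - intros n. rewrite tailval_qg by assumption.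
    pose proof (Hl (S n) ltac:(lia)). pose proof (Hap (S n) ltac:(lia)).
    pose proof (qg_rem_bounds beta (S n) Hb). split; intros _; lra.
  - rewrite tailval_qg by assumption. reflexivity.
Qed.

Lemma periodic_in_closure beta p : 1 < beta < 2 ->
  large_remainders beta ->
  (1 <= p)%nat -> qg_rem beta p = 1 -> in_closure_U beta.
Proof.
  intros Hb Hl Hp Hrp eps Heps. set (al := qg_digits beta).
  (* [mu] separates all remainders from [cap beta - 1], and those different from 1 from 1; the
     filler 1 covers remainders equal to 1. *)
  destruct (periodic_positive_min
    (fun n => Rmin (qg_rem beta n - (cap beta - 1))
                   (if Req_dec_T (qg_rem beta n) 1 then 1 else 1 - qg_rem beta n)) p)
    as [mu [Hmu Hmin]]; [lia| |intros k; rewrite qg_rem_period by assumption; reflexivity|].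
  { intros k. pose proof (large_remainder beta k Hb Hl). pose proof (qg_rem_bounds beta k Hb).
    apply Rmin_glb_lt; [lra|]. destruct (Req_dec_T (qg_rem beta k) 1); lra. }
  destruct (univoque_approximation beta 0 (mu / 2) Hb Hl ltac:(lra))
    as [e [del [_ [He0 [Hdel He]]]]].
  set (nu := Rmin (mu / 2) del).
  assert (Hnu : 0 < nu) by (apply Rmin_glb_lt; lra).
  assert (Hnu1 : nu <= mu / 2) by apply Rmin_l.
  assert (Hnu2 : nu <= del) by apply Rmin_r.
  (* Moving to a base within [d] of [beta] changes every tail value by less than [nu]. *)
  destruct (cap_continuous beta nu (proj1 Hb) Hnu) as [d [Hd Hcap]].
  set (lo := beta - Rmin eps d / 2).
  assert (0 < Rmin eps d) by (apply Rmin_glb_lt; lra).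
  pose proof (Rmin_l eps d). pose proof (Rmin_r eps d).
  destruct (Hcap lo) as [Hlo _]; [apply Rabs_def1; unfold lo; lra|].
  assert (Hlob : lo < beta) by (unfold lo; lra).
  pose proof (qg_value_smaller_base lo beta ltac:(lra) (proj2 Hb)) as HP. fold al in HP.
  (* Replacing the digits after position [K] changes the value in base [lo] by at most
     [cap lo / lo ^ K], which is too little to bring it down to 1. *)
  destruct (pow_unbounded lo (cap lo / (tailval lo al 0 - 1)) Hlo) as [N HN].
  set (K := (S N * p)%nat).
  assert (HK : qg_rem beta K = 1) by (apply qg_rem_multiple, Hrp).
  specialize (HN K ltac:(unfold K; nia)).
  set (c := splice K al e).
  assert (HcK : forall g i, tailval g c (K + i) = tailval g e i)
    by (intros; apply tailval_splice).
  assert (Hck : forall g n, 1 < g -> (n <= K)%nat ->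
            tailval g c n - tailval g al n = g ^ n * (tailval g c 0 - tailval g al 0)).
  { intros g n Hg Hn. apply tailval_agree; [assumption|].
    intros k Hk. apply splice_agree. lia. }
  assert (Hbc : tailval beta c 0 < 1).
  { pose proof (Hck beta K (proj1 Hb) (Nat.le_refl K)) as E.
    rewrite <- (Nat.add_0_r K) in E at 1. rewrite HcK in E.
    unfold al in E. rewrite !tailval_qg, HK in E by assumption.
    change (qg_rem beta 0) with 1 in E. specialize (He O).
    assert (0 < beta ^ K) by (apply pow_lt; lra). nra. }
  assert (Hloc : 1 < tailval lo c 0).
  { pose proof (Hck lo K Hlo (Nat.le_refl K)) as E.
    rewrite <- (Nat.add_0_r K) in E at 1. rewrite HcK in E.
    pose proof (tailval_bounds lo e 0 Hlo). pose proof (tailval_bounds lo al K Hlo).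
    assert (0 < lo ^ K) by (apply pow_lt; lra).
    apply Rmult_lt_compat_r with (r := tailval lo al 0 - 1) in HN; [|lra].
    unfold Rdiv in HN. rewrite Rmult_assoc, Rinv_l in HN by lra. nra. }
  (* The value of [c] exceeds 1 in base [lo] and is below 1 in base [beta]. *)
  destruct (IVT_interv (fun g => 1 - tailval g c 0) lo beta) as [g [Hg Hgz]]; [|lra|lra|lra|].
  { intros x Hx. apply continuity_pt_minus; [apply continuity_pt_const; intros ? ?; reflexivity|].
    apply tailval_base_continuous. lra. }
  assert (Hgc : tailval g c 0 = 1) by lra. clear Hgz.
  assert (Hgb : g < beta).
  { destruct (Rle_lt_or_eq_dec g beta (proj2 Hg)) as [|E]; [assumption|].
    rewrite E in Hgc. lra. }
  destruct (Hcap g) as [Hg1 Hgcap]; [apply Rabs_def1; unfold lo in Hg; lra|].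
  apply Rabs_def2 in Hgcap.
  exists g. split; [|apply Rabs_def1; unfold lo in Hg; lra].
  apply (in_U_intro g c); [lra| |assumption].
  (* Before [K] the tail lies below the remainder by at most [1 - tailval beta e 0 < mu / 2]. The
     margin [nu] absorbs the later change from [cap beta] to [cap g]. *)
  assert (Hlow : forall n, cap beta - 1 + nu <= tailval beta c n).
  { intros n. destruct (Nat.le_gt_cases K n) as [Hn|Hn].
    - replace n with (K + (n - K))%nat by lia. rewrite HcK. specialize (He (n - K)%nat). lra.
    - pose proof (Hck beta n (proj1 Hb) ltac:(lia)) as E.
      pose proof (Hck beta K (proj1 Hb) ltac:(lia)) as EK.
      rewrite <- (Nat.add_0_r K) in EK at 1. rewrite HcK in EK.
      unfold al in E, EK. rewrite !tailval_qg in E, EK by assumption. rewrite HK in EK.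
      change (qg_rem beta 0) with 1 in *.
      assert (beta ^ n <= beta ^ K) by (apply Rle_pow; [lra|lia]).
      assert (0 < beta ^ n) by (apply pow_lt; lra).
      pose proof (Hmin n) as M. pose proof (Rle_trans _ _ _ M (Rmin_l _ _)). nra. }
  assert (Hup : forall n, (1 <= n)%nat -> tailval g c n < 1).
  { intros n Hn1. pose proof (tailval_base_bound g beta c n ltac:(lra)) as B.
    destruct (Nat.le_gt_cases K n) as [Hn|Hn].
    - replace n with (K + (n - K))%nat in * by lia. rewrite !HcK in *.
      specialize (He (n - K)%nat). lra.
    - destruct (Req_dec_T (qg_rem beta n) 1) as [E1|E1].
      (* Here [al] restarts at [n]. With [P > 1] its value in base [g], the tail of [c] is
         [P - g ^ n * (P - 1)], which is below 1. *)
      + pose proof (Hck g n Hg1 ltac:(lia)) as E. unfold al in E.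
        rewrite tailval_qg_period, Hgc in E by assumption.
        pose proof (qg_value_smaller_base g beta ltac:(lra) (proj2 Hb)).
        assert (1 < g ^ n) by (apply Rlt_pow_R1; [assumption|lia]). nra.
      + pose proof (Hmin n) as M. apply Rle_trans with (2 := Rmin_r _ _) in M.
        destruct (Req_dec_T (qg_rem beta n) 1); [contradiction|].
        pose proof (Hck beta n (proj1 Hb) ltac:(lia)) as E.
        unfold al in E. rewrite !tailval_qg in E by assumption.
        change (qg_rem beta 0) with 1 in E.
        assert (0 < beta ^ n) by (apply pow_lt; lra). nra. }
  intros n. split; intros _; [apply Hup; lia|].
  pose proof (tailval_base_mono g beta c (S n) ltac:(lra)). specialize (Hlow (S n)). lra.
Qed.

Lemma large_remainders_in_closure beta : 1 < beta < 2 ->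
  large_remainders beta -> in_closure_U beta.
Proof.
  intros Hb Hl.
  destruct (classic (exists p, (1 <= p)%nat /\ qg_rem beta p = 1)) as [[p [Hp Hrp]]|Hno].
  - exact (periodic_in_closure beta p Hb Hl Hp Hrp).
  - intros eps He. exists beta. split; [|rewrite Rminus_diag, Rabs_R0; assumption].
    apply aperiodic_in_U; [assumption|assumption|]. intros k Hk E. apply Hno. exists k. auto.
Qed.

(** * Implications between the classes of shifts, and the equivalence *)

Lemma subshift_closed (Y : bseq -> Prop) : is_subshift Y -> is_closed Y.
Proof.
  intros [F HF] x Hx. apply HF. intros w Hw [i Hi].
  destruct (Hx (i + length w)%nat) as [y [Hy Hag]].
  apply (proj1 (HF y) Hy w Hw). exists i. intros k Hk d.
  rewrite <- Hag by lia. apply Hi, Hk.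
Qed.

Lemma SFT_subshift (Y : bseq -> Prop) : is_SFT Y -> is_subshift Y.
Proof. intros [F HF]. exists (fun w => In w F). exact HF. Qed.

Lemma SFT_sofic (Y : bseq -> Prop) : is_SFT Y -> is_sofic Y.
Proof.
  intros H. split; [apply SFT_subshift, H|].
  exists bool, (true :: false :: nil). unshelve eexists; [intros []; simpl; auto|].
  exists Y, (fun x => x). repeat split; auto.
  - intros y Hy. exists y. auto.
  - intros x _ n. exists n. auto.
Qed.

Theorem theorem4p7 (beta : R) (Hbeta : 1 < beta < 2) :
  (~ in_closure_U beta <-> is_subshift (Utilde beta)) /\
  (~ in_closure_U beta <-> is_SFT (Utilde beta)) /\
  (~ in_closure_U beta <-> is_closed (Utilde beta)) /\
  (~ in_closure_U beta <-> is_sofic (Utilde beta)) /\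
  ~ is_strictly_sofic (Utilde beta).
Proof.
  (* Finite type gives all the other shift properties and each of them implies closedness, so these
     two cases settle every equivalence. *)
  assert (Hdich : ~ in_closure_U beta /\ is_SFT (Utilde beta) \/
                  in_closure_U beta /\ ~ is_closed (Utilde beta)).
  { destruct (classic (exists k, (1 <= k)%nat /\ qg_rem beta k <= cap beta - 1)) as [Hs|Hl].
    - left. split; [apply small_remainder_not_closure; assumption|].
      destruct (small_remainder_gap beta Hbeta Hs) as [del [Hd Hgap]].
      exact (gap_SFT beta del Hbeta Hd Hgap).
    - right.
      assert (Hl' : large_remainders beta).
      { intros k Hk. apply Rnot_le_lt. intros H. apply Hl. exists k. auto. }
      split; [apply large_remainders_in_closure; assumption|].
      apply large_remainders_not_closed; assumption. }
  pose proof (subshift_closed (Utilde beta)). pose proof (SFT_subshift (Utilde beta)).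
  pose proof (SFT_sofic (Utilde beta)).
  assert (is_sofic (Utilde beta) -> is_subshift (Utilde beta)) by (intros [? _]; assumption).
  unfold is_strictly_sofic. tauto.
Qed.
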